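(* For every integer $\ell\ge 2$, no witness of $D_{3\ell}(H_\ell)$ has size less than $|H_\ell|=6\ell-2$.
   Context: $\Lambda_i$ denotes the poset with $i$ minimal elements and one further element above all of them. $H_\ell$ is the poset whose connected components are $\ell$ copies of $\Lambda_2$ and one copy of $\Lambda_{3(\ell-1)}$. A downset is a downward-closed subset; $D_n(Q)$ is the set of downsets of $Q$ of size $n$ up to isomorphism. $Q$ is a witness of a set $\Gamma_n$ of unlabelled posets of size $n$ if $D_n(Q)=\Gamma_n$. *)

(* Defs.v *)
From mathcomp Require Import all_boot.
Set Implicit Arguments. Unset Strict Implicit. Unset Printing Implicit Defensive.

Definition is_poset (T : finType) (le : rel T) : Prop :=
  [/\ reflexive le, antisymmetric le & transitive le].

Definition downset (T : finType) (le : rel T) (A : {set T}) : Prop :=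
  forall x y, y \in A -> le x y -> x \in A.

Definition induced_iso (T U : finType) (leT : rel T) (leU : rel U)
    (A : {set T}) (B : {set U}) : Prop :=
  exists f : T -> U,
    [/\ {in A &, injective f}, f @: A = B &
        {in A &, forall x y, leU (f x) (f y) = leT x y}].

Definition Dn_incl (n : nat) (T U : finType) (leT : rel T) (leU : rel U) : Prop :=
  forall A : {set T}, downset leT A -> #|A| = n ->
    exists B : {set U}, [/\ downset leU B, #|B| = n & induced_iso leT leU A B].

(* D_n(T) = D_n(U) as sets of unlabelled posets. *)
Definition same_Dn (n : nat) (T U : finType) (leT : rel T) (leU : rel U) : Prop :=
  Dn_incl n leT leU /\ Dn_incl n leU leT.

Definition witness_of (n : nat) (Q P : finType) (leQ : rel Q) (leP : rel P) : Prop :=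
  same_Dn n leQ leP.

(* H_l : l copies of Lambda_2 (elements inl (k, i), k < l, i < 3; i = 2 is the
   top) and one copy of Lambda_{3(l-1)} (elements inr a, a < 3(l-1)+1;
   a = ord_max is the top). Size 3l + 3(l-1) + 1 = 6l - 2 for l >= 1. *)
Definition H_pt (l : nat) : finType :=
  ((('I_l * 'I_3)%type) + 'I_(3 * (l - 1)).+1)%type.

Definition H_le (l : nat) : rel (H_pt l) := fun x y =>
  match x, y with
  | inl (k, i), inl (k', i') => (k == k') && ((i == i') || (nat_of_ord i' == 2))
  | inr a, inr b => (a == b) || (b == ord_max)
  | _, _ => false
  end.
Arguments H_le l : clear implicits.

(* Main.v *)
Require Import Defs.
From mathcomp Require Import all_boot.
From mathcomp Require Import zify.
Set Implicit Arguments. Unset Strict Implicit. Unset Printing Implicit Defensive.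

(* Let Q be a witness with fewer than 6l - 2 elements.  The downsets l.Lambda_2
   and Lambda_{3(l-1)} + 2 points of H_l give a downset X of Q isomorphic to
   l.Lambda_2 and an element t with 3l - 2 elements below it; so t is not in X
   and, by counting, some m in X lies below t.  As m is comparable to another
   element of X, some a in X lies strictly below both t and some x in X.  The
   elements below x or t number at most 3 + (3l - 2) - 1 = 3l; a downset of
   size 3l containing them is isomorphic to a downset of H_l, in which a would
   have the two strict upper bounds x <> t, whereas in H_l no element has two. *)

Definition below (T : finType) (le : rel T) (a : T) : {set T} := [set z | le z a].

Lemma card_sum_set (A B : finType) (P : pred (A + B)) :
  #|[set x | P x]| = #|[set a | P (inl a)]| + #|[set b | P (inr b)]|.
Proof. by rewrite !cardsE -!sum1_card big_sumType. Qed.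

Section Downsets.

Variables (T : finType) (le : rel T).
Hypothesis le_poset : is_poset le.

Lemma downset_below a : downset le (below le a).
Proof.
by case: le_poset => _ _ le_trans x y; rewrite !inE => ya xy; apply: le_trans ya.
Qed.

Lemma downset_setU1 (D : {set T}) y :
  downset le D -> (forall z, le z y -> z != y -> z \in D) -> downset le (y |: D).
Proof.
move=> downD below_y x z; rewrite !inE => /orP[/eqP -> xy|zD xz].
  by case: eqP => //= /eqP; apply: below_y.
by rewrite (downD _ _ zD xz) orbT.
Qed.

(* An element outside D with the fewest elements below it has all its strict
   predecessors in D. *)
Lemma exists_minimal_notin (D : {set T}) y0 :
  y0 \notin D -> exists2 y, y \notin D & forall z, le z y -> z != y -> z \in D.
Proof.
case: le_poset => le_refl le_anti le_trans y0D.
have [y yD ymin] := @arg_minnP _ y0 (fun y => y \notin D) (fun y => #|below le y|) y0D.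
exists y => // z zy zny; apply/negPn/negP => zD.
have /proper_card : below le z \proper below le y.
  apply/properP; split.
    by apply/subsetP => w; rewrite !inE => /le_trans; apply.
  exists y; rewrite !inE ?le_refl //; apply: contra zny => yz.
  by rewrite (@le_anti z y) ?zy.
by rewrite ltnNge ymin.
Qed.

Lemma downset_extend (D : {set T}) n :
  downset le D -> #|D| <= n <= #|T| ->
  exists D', [/\ downset le D', D \subset D' & #|D'| = n].
Proof.
have [k gapD] : exists k, n - #|D| = k by exists (n - #|D|).
elim: k D gapD => [|k IHk] D gapD downD /andP[Dn nT].
  by exists D; split => //; apply/eqP; rewrite eqn_leq Dn; lia.
have /set0Pn[y0] : ~: D != set0 by rewrite -card_gt0; have := cardsC D; lia.
rewrite inE => /exists_minimal_notin[y yD ymin].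
have [|||D' [downD' yDD' D'n]] := IHk (y |: D).
- by rewrite cardsU1 yD; lia.
- exact: downset_setU1.
- by rewrite cardsU1 yD nT; lia.
by exists D'; split => //; apply: subset_trans yDD'; apply: subsetUr.
Qed.

End Downsets.

Section InducedIso.

Variables (T U : finType) (leT : rel T) (leU : rel U).
Variables (A : {set T}) (B : {set U}) (f : T -> U).
Hypotheses (downA : downset leT A) (downB : downset leU B).
Hypotheses (f_inj : {in A &, injective f}) (fAB : f @: A = B).
Hypothesis f_mono : {in A &, forall x y, leU (f x) (f y) = leT x y}.

Lemma below_subset a : a \in A -> below leT a \subset A.
Proof. by move=> aA; apply/subsetP => z; rewrite inE; apply: downA. Qed.

Lemma imset_below a : a \in A -> f @: below leT a = below leU (f a).
Proof.
move=> aA; apply/setP => y; apply/imsetP/idP => [[z za ->]|].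
  have zA : z \in A := subsetP (below_subset aA) z za.
  by move: za; rewrite !inE f_mono.
rewrite inE => ya.
have /downB/(_ ya) : f a \in B by rewrite -fAB imset_f.
rewrite -fAB => /imsetP[z zA yz]; exists z => //.
by rewrite inE -f_mono // -yz.
Qed.

Lemma card_below_iso a : a \in A -> #|below leU (f a)| = #|below leT a|.
Proof.
move=> aA; rewrite -imset_below // card_in_imset //.
by apply: sub_in2 f_inj => z; apply/subsetP/below_subset.
Qed.

End InducedIso.

Definition unique_strict_upper (T : finType) (le : rel T) : Prop :=
  forall a b c, le a b -> le a c -> a != b -> a != c -> b = c.

(* Completing [below b :|: below c] to a downset of size [n] transports a
   pair of strict upper bounds of [a] into the poset U. *)
Lemma Dn_incl_unique_strict_upper n (T U : finType) (leT : rel T) (leU : rel U) :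
    is_poset leT -> Dn_incl n leT leU -> unique_strict_upper leU -> n <= #|T| ->
  forall a b c, #|below leT b :|: below leT c| <= n ->
    leT a b -> leT a c -> a != b -> a != c -> b = c.
Proof.
move=> posetT inclTU uniqU nT a b c small leab leac ab ac.
have down_bc : downset leT (below leT b :|: below leT c).
  move=> x y; rewrite !in_setU => /orP[yb|yc] xy.
    by rewrite (downset_below posetT yb xy).
  by rewrite (downset_below posetT yc xy) orbT.
have [D [downD bcD Dn]] := downset_extend posetT down_bc (introT andP (conj small nT)).
have [bD cD aD] : [/\ b \in D, c \in D & a \in D].
  have [le_refl _ _] := posetT.
  by split; apply: (subsetP bcD); rewrite !inE ?leab ?le_refl ?orbT.
have [_ [_ _ [h [h_inj _ h_mono]]]] := inclTU D downD Dn.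
apply: (h_inj b c bD cD); apply: (uniqU (h a)).
- by rewrite h_mono.
- by rewrite h_mono.
- by apply: contra ab => /eqP/(h_inj a b aD bD)->.
- by apply: contra ac => /eqP/(h_inj a c aD cD)->.
Qed.

Section HPoset.

Variable l : nat.

Lemma unique_strict_upper_H : unique_strict_upper (H_le l).
Proof.
move=> [[k i]|a] [[k1 i1]|b] [[k2 i2]|c] //=.
- move=> /andP[/eqP <- /orP[/eqP <-|/eqP i1top]];
  move=> /andP[/eqP <- /orP[/eqP <-|/eqP i2top]]; rewrite ?eqxx // => _ _.
  by congr (inl (_, _)); apply: val_inj; rewrite /= i1top i2top.
- move=> /orP[/eqP <-|/eqP ->]; rewrite ?eqxx // => /orP[/eqP <-|/eqP ->] //.
  by rewrite eqxx.
Qed.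

Lemma card_below_H_inl k i : #|below (H_le l) (inl (k, i))| <= 3.
Proof.
have : below (H_le l) (inl (k, i)) \subset [set inl (k, j) | j : 'I_3].
  apply/subsetP => -[[k' j]|b]; rewrite inE //= => /andP[/eqP -> _].
  exact: imset_f.
by move/subset_leq_card/leq_trans; apply; rewrite (leq_trans (leq_imset_card _ _)) ?card_ord.
Qed.

Lemma card_below_H_top : #|below (H_le l) (inr ord_max)| = (3 * (l - 1)).+1.
Proof.
rewrite card_sum_set.
have -> : [set a | H_le l (inl a) (inr ord_max)] = set0 by apply/setP => -[k i]; rewrite !inE.
have -> : [set b | H_le l (inr b) (inr ord_max)] = setT.
  by apply/setP => b; rewrite !inE /= eqxx orbT.
by rewrite cards0 cardsT card_ord.
Qed.

Definition H_Lambda2s : {set H_pt l} := [set x | if x is inl _ then true else false].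

Lemma downset_H_Lambda2s : downset (H_le l) H_Lambda2s.
Proof. by move=> [[k i]|a] [[k' i']|b]; rewrite !inE. Qed.

Lemma card_H_Lambda2s : #|H_Lambda2s| = 3 * l.
Proof.
by rewrite card_sum_set cards0 cardsT card_prod !card_ord addn0 mulnC.
Qed.

Definition H_Lambda_and_two_minima (k0 : 'I_l) : {set H_pt l} :=
  [set x | if x is inl p then p \in setX [set k0] [set~ ord_max] else true].

Lemma downset_H_Lambda_and_two_minima k0 : downset (H_le l) (H_Lambda_and_two_minima k0).
Proof.
move=> [[k i]|a] [[k' i']|b]; rewrite !inE //= => /andP[k'0 i'top].
case/andP=> /eqP -> /orP[/eqP -> |i'2]; rewrite ?k'0 ?i'top //.
by rewrite -val_eqE /= (eqP i'2) in i'top.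
Qed.

Lemma card_H_Lambda_and_two_minima k0 : #|H_Lambda_and_two_minima k0| = 3 * l.
Proof.
rewrite card_sum_set cardsE cardsX cards1 cardsC1 cardsT !card_ord.
by case: k0 => k; lia.
Qed.

Lemma Dn_incl_H_Lambda2s (Q : finType) (leQ : rel Q) :
  Dn_incl (3 * l) (H_le l) leQ ->
  exists X : {set Q}, [/\ #|X| = 3 * l, {in X, forall x, #|below leQ x| <= 3} &
    {in X, forall x, exists2 y, y \in X & (y != x) && (leQ y x || leQ x y)}].
Proof.
move=> inclHQ.
have [X [downX Xc [g [g_inj gX g_mono]]]] :=
  inclHQ _ downset_H_Lambda2s card_H_Lambda2s.
have iso_below := card_below_iso downset_H_Lambda2s downX g_inj gX g_mono.
exists X; split => // x; rewrite -gX => /imsetP[a aA ->].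
all: case: a aA => [[k i]|a] aA; last by rewrite inE in aA.
  by rewrite iso_below ?card_below_H_inl.
pose b : H_pt l := inl (k, if i == ord_max then ord0 else ord_max).
have bA : b \in H_Lambda2s by rewrite inE.
exists (g b); first exact: imset_f.
have ji : (if i == ord_max then ord0 else ord_max) != i.
  by case: (i =P ord_max) => [->|/nesym/eqP].
rewrite !g_mono // /= eqxx /=; apply/andP; split.
  by apply: contra ji => /eqP/(g_inj _ _ bA aA)[->].
by case: (i =P ord_max) => [->|_] //=; rewrite eqxx !orbT.
Qed.

Lemma Dn_incl_H_Lambda_top (Q : finType) (leQ : rel Q) :
  0 < l -> Dn_incl (3 * l) (H_le l) leQ ->
  exists t : Q, #|below leQ t| = (3 * (l - 1)).+1.
Proof.
move=> l_gt0 inclHQ; pose k0 : 'I_l := Ordinal l_gt0.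
have [Y [downY _ [f [f_inj fY f_mono]]]] := inclHQ _
  (@downset_H_Lambda_and_two_minima k0) (@card_H_Lambda_and_two_minima k0).
exists (f (inr ord_max)).
by rewrite (card_below_iso _ downY f_inj fY f_mono) ?card_below_H_top ?inE //;
  exact: downset_H_Lambda_and_two_minima.
Qed.

End HPoset.

Theorem mainTheorem8 (l : nat) (hl : 2 <= l)
    (Q : finType) (leQ : rel Q) (hQ : is_poset leQ) :
  witness_of (3 * l) leQ (H_le l) -> 6 * l - 2 <= #|Q|.
Proof.
move=> [inclQH inclHQ]; rewrite leqNgt; apply/negP => Q_small.
have [X [Xc X_below X_comparable]] := Dn_incl_H_Lambda2s inclHQ.
have [t t_below] := Dn_incl_H_Lambda_top (ltnW hl) inclHQ.
have XQ : 3 * l <= #|Q| by rewrite -Xc max_card.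
have tX : t \notin X by apply/negP => /X_below; rewrite t_below; lia.
have [m mX mt] : exists2 m, m \in X & leQ m t.
  have : X :&: below leQ t != set0.
    rewrite -card_gt0; have := cardsUI X (below leQ t).
    by have := max_card (X :|: below leQ t); lia.
  by case/set0Pn => m; rewrite !inE => /andP[]; exists m.
have [a [x [aX xX a_le_x a_le_t a_ne_x]]] :
    exists a x, [/\ a \in X, x \in X, leQ a x, leQ a t & a != x].
  have [y yX /andP[ym /orP[ylem|mley]]] := X_comparable m mX.
    by exists y, m; split => //; case: hQ => _ _ /(_ _ _ _ ylem mt).
  by exists m, y; split; rewrite // eq_sym.
have common : 0 < #|below leQ x :&: below leQ t|.
  by apply/card_gt0P; exists a; rewrite !inE a_le_x a_le_t.
have small_union : #|below leQ x :|: below leQ t| <= 3 * l.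
  by have := cardsUI (below leQ x) (below leQ t); have := X_below x xX; lia.
have a_ne_t : a != t by apply: contraNneq tX => <-.
have xt := Dn_incl_unique_strict_upper hQ inclQH (@unique_strict_upper_H l) XQ
  small_union a_le_x a_le_t a_ne_x a_ne_t.
by rewrite -xt xX in tX.
Qed.
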